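(* Let $N\ge 2$ be an even integer. If $t\in\mathrm{TNS}(G_{2\times N},2,2)\subset(\mathbb{C}^2)^{\otimes 2N}$ is generic, then its border rank satisfies $\underline{R}(t)\ge 2^N$.
   Context: The graph $G_{2\times N}$ (the $2\times N$ grid on a torus) has $2N$ vertices: upper vertices $1,\dots,N$ and lower vertices $1',\dots,N'$, with column indices read modulo $N$. Every vertex is incident to five edges: an up edge, a right edge, a down edge, a left edge, and one dangling edge (an edge attached to only one vertex), called the physical edge. The right edge of $p$ is the left edge of $p+1$, and the right edge of $p'$ is the left edge of $(p+1)'$ (indices modulo $N$); the down edge of $p$ is the up edge of $p'$, and the down edge of $p'$ is the up edge of $p$ (so $p$ and $p'$ are joined by two distinct edges; likewise for $N=2$ horizontal neighbours are joined by two distinct edges). These $4N$ non-dangling edges are the entanglement edges, and there are $2N$ physical edges. Unbound tensor network state $\mathrm{TNS}(G,d,k)$: attach $W_p=\mathbb{C}^k$ to each physical edge $p$ and $\mathbb{C}^d$ to each entanglement edge, and orient each entanglement edge (the choice is immaterial). For each vertex $v$ let $\mathbf V_v$ be the tensor product of $W_p$ for the physical edge $p$ at $v$, one factor $\mathbb{C}^d$ for each entanglement edge directed towards $v$, and one factor $(\mathbb{C}^d)^*$ for each entanglement edge directed away from $v$. Given tensors $T_v\in\mathbf V_v$, one for each vertex, contracting $\bigotimes_v T_v$ along every entanglement edge (pairing the two corresponding factors $\mathbb{C}^d$ and $(\mathbb{C}^d)^*$) gives a tensor $\psi((T_v)_v)\in\bigotimes_p W_p$. The set of all tensors so obtained is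 $\mathrm{TNS}(G,d,k)$. Rank and border rank: a tensor in $W_1\otimes\cdots\otimes W_l$ has rank one if it is of the form $w_1\otimes\cdots\otimes w_l$ with $w_j \in W_j$; the rank of a tensor is the smallest $r$ such that it is a sum of $r$ rank one tensors; the border rank $\underline{R}(t)$ is the smallest $r$ such that $t$ is a limit of tensors of rank $r$. Generic: a property holds for a generic $t\in\mathrm{TNS}(G,d,k)$ if it holds for $\psi((T_v)_v)$ for all $(T_v)_v$ in some nonempty Zariski open subset of $\bigoplus_v\mathbf V_v$. *)

(* Defs.v *)
From HB Require Import structures.
From mathcomp Require Import all_boot all_order all_algebra.
From mathcomp Require Import complex.
From mathcomp Require Import all_classical all_reals all_analysis.
(* Not imported: its notations clash with those of MathComp-Analysis. *)
From mathcomp Require mpoly.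

Set Implicit Arguments.
Unset Strict Implicit.
Unset Printing Implicit Defensive.

Import Order.TTheory GRing.Theory Num.Theory.
Import numFieldNormedType.Exports.

Local Open Scope classical_set_scope.
Local Open Scope ring_scope.

(* A tensor in the tensor product over i : I of copies of K^k is represented by
   the array of its coordinates in the standard product basis. *)
Notation tensor K I k := {ffun {ffun I -> 'I_k} -> K}.

(* The least n satisfying P.  The value 0 when there is none is never used for
   the ranks below: every tensor with at least one factor is a finite sum of
   rank one tensors.  Since 0 is the smallest possible value, it could not help
   a lower bound in any case. *)
Definition least (P : nat -> Prop) : nat :=
  if pselect (exists n, `[< P n >]) is left exP then ex_minn exP else 0%N.

Definition rank_one (K : fieldType) (I : finType) (k : nat)
    (t : tensor K I k) : Prop :=
  exists w : I -> 'I_k -> K, forall x, t x = \prod_(i : I) w i (x i).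

Definition sum_of_rank_one (K : fieldType) (I : finType) (k : nat)
    (t : tensor K I k) (r : nat) : Prop :=
  exists s : 'I_r -> tensor K I k,
    (forall j, rank_one (s j)) /\ t = \sum_(j < r) s j.

Definition tensor_rank (K : fieldType) (I : finType) (k : nat)
    (t : tensor K I k) : nat :=
  least (sum_of_rank_one t).

(* Convergence in the finite-dimensional tensor space is convergence of every
   coordinate. *)
Definition limit_of_rank (K : numFieldType) (I : finType) (k : nat)
    (t : tensor K I k) (r : nat) : Prop :=
  exists u : nat -> tensor K I k,
    (forall n, tensor_rank (u n) = r) /\
    (forall x, (fun n => u n x) @ \oo --> t x).

Definition border_rank (K : numFieldType) (I : finType) (k : nat)
    (t : tensor K I k) : nat :=
  least (limit_of_rank t).

(* Graphs with exactly one physical (dangling) edge at each vertex, so that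
   physical edges are identified with vertices.  An entanglement edge e is
   oriented from src e to tgt e; multiple edges are allowed. *)
Record tn_graph := TNGraph {
  vertex : finType;
  ent_edge : finType;
  src : ent_edge -> vertex;
  tgt : ent_edge -> vertex
}.

Section TensorNetwork.
Variables (K : fieldType) (G : tn_graph) (d k : nat).

(* The standard basis of V_v : a basis index of the physical space K^k, one of
   K^d for each edge directed towards v, and one of the dual space (K^d)^* (in
   the dual basis) for each edge directed away from v. *)
Definition local_index (v : vertex G) : finType :=
  ('I_k * {ffun {e : ent_edge G | tgt e == v} -> 'I_d}
        * {ffun {e : ent_edge G | src e == v} -> 'I_d})%type.

(* The standard basis of the direct sum of the spaces V_v. *)
Definition param_index : finType := {v : vertex G & local_index v}.

(* The family (T_v)_v, as an element of the direct sum of the spaces V_v: the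
   coordinates of T_v are those with first component v. *)
Definition params := {ffun param_index -> K}.

Definition local_tensor (T : params) (v : vertex G) (i : local_index v) : K :=
  T (Tagged local_index i).

(* c assigns to each entanglement edge a basis index of K^d; pairing K^d with
   its dual in dual bases amounts to summing over all such c. *)
Definition psi (T : params) : tensor K (vertex G) k :=
  [ffun x : {ffun vertex G -> 'I_k} =>
    \sum_(c : {ffun ent_edge G -> 'I_d})
      \prod_(v : vertex G)
        local_tensor T (x v, [ffun e : {e : ent_edge G | tgt e == v} => c (val e)],
                             [ffun e : {e : ent_edge G | src e == v} => c (val e)])].

Definition TNS : set (tensor K (vertex G) k) := range psi.

End TensorNetwork.

Definition zariski_closed (K : fieldType) (I : finType)
    (Z : set {ffun I -> K}) : Prop :=
  exists S : set (mpoly.mpoly #|I| K),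
    Z = [set y | forall p, S p -> mpoly.meval (fun j => y (enum_val j)) p = 0].

Definition zariski_open (K : fieldType) (I : finType)
    (U : set {ffun I -> K}) : Prop := zariski_closed (~` U).

Definition generic_in_TNS (K : fieldType) (G : tn_graph) (d k : nat)
    (P : tensor K (vertex G) k -> Prop) : Prop :=
  exists U : set (params K G d k),
    [/\ zariski_open U, U !=set0 & forall T, U T -> P (psi T)].

(* The 2 x N grid on a torus: (i, false) is the upper and (i, true) the lower
   vertex of column i.  The edge (v, false) is the right edge of v, and the edge
   (v, true) is the down edge of v, both oriented away from v. *)
Definition grid_vertex (N : nat) : finType := ('I_N * bool)%type.

Definition grid_right (N : nat) (v : grid_vertex N) : grid_vertex N :=
  (ordS v.1, v.2).

Definition grid_down (N : nat) (v : grid_vertex N) : grid_vertex N :=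
  (v.1, ~~ v.2).

Definition grid_edge (N : nat) : finType := (grid_vertex N * bool)%type.

Definition torus_grid2 (N : nat) : tn_graph :=
  @TNGraph (grid_vertex N) (grid_edge N)
    (fun e => e.1)
    (fun e => if e.2 then grid_down e.1 else grid_right e.1).

(* Main.v *)
Require Import Defs.
From mathcomp Require Import all_boot all_order all_algebra.
From mathcomp Require Import complex.
From mathcomp Require Import all_classical all_reals all_analysis.
From mathcomp Require Import -(notations) mpoly.

(** A flattening bounds the border rank from below.  Split the factors of a
    tensor into two halves indexed by the same set; its coordinates then form a
    square matrix, of size 2^N when upper and lower vertices of the grid are
    separated.  A sum of r rank one tensors flattens to a product of two
    matrices through an r-dimensional space ([rank_flat_le]), so a tensor with
    nonsingular flattening has rank at least 2^N.  The determinant being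
    continuous, nearby tensors also have nonsingular flattening, and the bound
    passes to the border rank ([border_rank_ge]).

    The determinant of the flattening of psi(T) is a polynomial in the entries
    of T, so its nonvanishing is a Zariski open condition, and one parameter
    where it does not vanish is enough.  Such a parameter is found by letting
    each upper vertex copy its physical index along its down edge to the lower
    vertex of the same column, and freezing all the other edges
    ([psi_copy_params]): the network then contracts to a product of N pairings
    of an upper vertex with the lower one, whose flattening is the identity. *)

Set Implicit Arguments.
Unset Strict Implicit.
Unset Printing Implicit Defensive.

Import Order.TTheory GRing.Theory Num.Theory.
Import numFieldNormedType.Exports.

Local Open Scope ring_scope.

(** * Rank and border rank are attained *)

Lemma leastP (P : nat -> Prop) : (exists n, P n) -> P (least P).
Proof.
move=> [n Pn]; rewrite /least; case: pselect => [exP|[]].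
  by case: ex_minnP => m /asboolP.
by exists n; apply/asboolP.
Qed.

(** Makes the minimum that defines the rank a genuine one.  The decomposition
    is the expansion in the product basis, the factor [i0] absorbing the
    coefficients. *)
Lemma ex_sum_of_rank_one (K : fieldType) (I : finType) (k : nat) (i0 : I)
    (t : tensor K I k) : exists r, sum_of_rank_one t r.
Proof.
exists #|{: {ffun I -> 'I_k}}|.
exists (fun j => [ffun x => t x * (x == enum_val j)%:R]); split=> [j|].
  pose y : {ffun I -> 'I_k} := enum_val j.
  exists (fun i a => (if i == i0 then t y else 1) * (a == y i)%:R) => x.
  rewrite ffunE -/y big_split /=.
  rewrite -big_mkcond /= big_pred1_eq.
  have [->|neq] := eqVneq x y.
    by rewrite big1 // => i _; rewrite eqxx.
  have [i xyi] : exists i, x i != y i.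
    by apply/existsP; apply: contraNT neq => /existsPn xy;
       apply/eqP/ffunP => i; apply/eqP/negPn/xy.
  by rewrite mulr0 (bigD1 i) //= (negPf xyi) mul0r mulr0.
apply/ffunP => x; rewrite sum_ffunE.
under eq_bigr do rewrite ffunE.
rewrite -(big_enum_val (A := predT) (fun y => t x * (x == y)%:R)) /=.
rewrite (bigD1 x) //= eqxx mulr1 big1 ?addr0 // => y.
by rewrite eq_sym => /negPf ->; rewrite mulr0.
Qed.

Lemma sum_of_tensor_rank (K : fieldType) (I : finType) (k : nat) (i0 : I)
    (t : tensor K I k) : sum_of_rank_one t (tensor_rank t).
Proof. by apply: (@leastP (sum_of_rank_one t)); apply: ex_sum_of_rank_one. Qed.

Lemma limit_of_border_rank (K : numFieldType) (I : finType) (k : nat)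
    (t : tensor K I k) : limit_of_rank t (border_rank t).
Proof.
apply: leastP; exists (tensor_rank t), (fun=> t).
by split=> // x; apply: cvg_cst.
Qed.

(** * Flattenings *)

Definition join_halves (J : finType) (A : Type) (a b : {ffun J -> A}) :
    {ffun J * bool -> A} :=
  [ffun v => if v.2 then b v.1 else a v.1].

Definition flat (K : fieldType) (J : finType) (k : nat)
    (t : tensor K (J * bool)%type k) : 'M[K]_#|{: {ffun J -> 'I_k}}| :=
  \matrix_(i, j) t (join_halves (enum_val i) (enum_val j)).

(** Each rank one term separates into a function of the row index times a
    function of the column index. *)
Lemma rank_flat_le (K : fieldType) (J : finType) (k r : nat)
    (t : tensor K (J * bool)%type k) :
  sum_of_rank_one t r -> (\rank (flat t) <= r)%N.
Proof.
move=> [s [/choice[w wE] ->]].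
pose half (b : bool) l (a : {ffun J -> 'I_k}) :=
  \prod_(j : J) w l (j, b) (a j).
have -> : flat (\sum_(l < r) s l) =
    (\matrix_(i, l) half false l (enum_val i)) *m
    (\matrix_(l, j) half true l (enum_val j)).
  apply/matrixP => i j; rewrite !mxE sum_ffunE; apply: eq_bigr => l _.
  rewrite !mxE wE -big_split /=.
  transitivity (\prod_(q : J) \prod_(b : bool)
      w l (q, b) (join_halves (enum_val i) (enum_val j) (q, b))).
    by rewrite pair_bigA; apply: eq_bigr => -[].
  by apply: eq_bigr => q _; rewrite big_bool !ffunE mulrC.
exact: leq_trans (mxrankM_maxl _ _) (rank_leq_col _).
Qed.

Lemma cvg_det (K : numFieldType) (n : nat) (M : nat -> 'M[K]_n) (A : 'M[K]_n) :
  (forall i j, (M m i j @[m --> \oo] --> A i j)%classic) ->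
  (\det (M m) @[m --> \oo] --> \det A)%classic.
Proof.
move=> MA; rewrite /determinant.
apply: cvg_big => [|s _]; first exact: add_continuous.
apply: cvgM; first exact: cvg_cst.
apply: cvg_big => [|i _]; first exact: mul_continuous.
exact: MA.
Qed.

(** If the border rank were smaller, the flattenings of the approximating
    tensors would be singular, and so would be that of their limit. *)
Lemma border_rank_ge (K : numFieldType) (J : finType) (k : nat) (j0 : J)
    (t : tensor K (J * bool)%type k) :
  \det (flat t) != 0 -> (k ^ #|J| <= border_rank t)%N.
Proof.
move=> det_t; have [u [u_rank u_t]] := limit_of_border_rank t.
rewrite leqNgt; apply: contra det_t => lt_rank; apply/eqP.
have det_u m : \det (flat (u m)) = 0.
  apply: contraTeq lt_rank => det_u; rewrite -leqNgt -(u_rank m).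
  have := rank_flat_le (sum_of_tensor_rank (j0, false) (u m)).
  by rewrite mxrank_unit ?unitmxE ?unitfE // card_ffun card_ord.
have flat_u : (\det (flat (u m)) @[m --> \oo] --> \det (flat t))%classic.
  by apply: cvg_det => i j; rewrite mxE; under eq_fun do rewrite mxE; apply: u_t.
move: flat_u; under eq_fun do rewrite det_u.
by move=> flat_u; apply: (norm_cvg_unique flat_u); apply: cvg_cst.
Qed.

(** * Polynomial functions and Zariski open sets *)

Definition polynomial_fun (K : fieldType) (I : finType)
    (f : {ffun I -> K} -> K) : Prop :=
  exists p : mpoly #|I| K,
    forall y : {ffun I -> K}, meval (fun j => y (enum_val j)) p = f y.

Section PolynomialFun.
Variables (K : fieldType) (I : finType).
Implicit Types f g : {ffun I -> K} -> K.

Lemma polynomial_cst c : polynomial_fun (fun _ : {ffun I -> K} => c).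
Proof. by exists (mpolyC #|I| c) => y; rewrite mevalC. Qed.

Lemma polynomial_coord i : polynomial_fun (fun y : {ffun I -> K} => y i).
Proof.
by exists (mpolyX K (mnm1 (enum_rank i))) => y; rewrite mevalXU enum_rankK.
Qed.

Lemma polynomialM f g :
  polynomial_fun f -> polynomial_fun g -> polynomial_fun (fun y => f y * g y).
Proof. by move=> [p pE] [q qE]; exists (p * q) => y; rewrite mevalM pE qE. Qed.

Lemma polynomial_sum (L : Type) (s : seq L) (P : pred L)
    (F : L -> {ffun I -> K} -> K) :
  (forall l, polynomial_fun (F l)) ->
  polynomial_fun (fun y => \sum_(l <- s | P l) F l y).
Proof.
move=> /choice[p pE]; exists (\sum_(l <- s | P l) p l) => y.
by rewrite raddf_sum; apply: eq_bigr => l _; apply: pE.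
Qed.

Lemma polynomial_prod (L : Type) (s : seq L) (P : pred L)
    (F : L -> {ffun I -> K} -> K) :
  (forall l, polynomial_fun (F l)) ->
  polynomial_fun (fun y => \prod_(l <- s | P l) F l y).
Proof.
move=> /choice[p pE]; exists (\prod_(l <- s | P l) p l) => y.
by rewrite rmorph_prod; apply: eq_bigr => l _; apply: pE.
Qed.

Lemma polynomial_det n (M : {ffun I -> K} -> 'M[K]_n) :
  (forall i j, polynomial_fun (fun y => M y i j)) ->
  polynomial_fun (fun y => \det (M y)).
Proof.
move=> Mpoly; apply: polynomial_sum => s.
apply: polynomialM; first exact: polynomial_cst.
by apply: polynomial_prod => i; apply: Mpoly.
Qed.

Lemma zariski_open_neq0 f :
  polynomial_fun f -> zariski_open [set y | f y != 0]%classic.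
Proof.
move=> [p pE]; exists [set p]%classic; apply/seteqP; split=> y /=.
  by move=> /negP/negPn/eqP fy0 _ ->; rewrite pE.
by move=> /(_ p erefl) py0; rewrite -pE py0 eqxx.
Qed.

End PolynomialFun.

(** Each coordinate of the contraction is a sum of monomials, with one entry of
    the local tensor of each vertex. *)
Lemma polynomial_psi (K : fieldType) (G : tn_graph) (d k : nat) x :
  polynomial_fun (fun T : params K G d k => psi T x).
Proof.
have [p pE] : polynomial_fun (fun T : params K G d k =>
    \sum_(c : {ffun ent_edge G -> 'I_d}) \prod_(v : vertex G)
    local_tensor T (x v, [ffun e : {e : ent_edge G | tgt e == v} => c (val e)],
                         [ffun e : {e : ent_edge G | src e == v} => c (val e)])).
  apply: polynomial_sum => c; apply: polynomial_prod => v.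
  exact: polynomial_coord.
by exists p => T; rewrite pE ffunE.
Qed.

(** * Copying physical indices along edges *)

(** A tensor product of Bell pairs, one for each edge of [M], when [M] is a
    matching: the edges outside [M] are frozen so that they correlate nothing. *)
Definition copy_tensor (K : fieldType) (G : tn_graph) (k : nat)
    (M : pred (ent_edge G)) (v : vertex G) (i : local_index k.+1 k.+1 v) : K :=
  ([forall e, i.1.2 e == if M (val e) then i.1.1 else ord0] &&
   [forall e, i.2 e == if M (val e) then i.1.1 else ord0])%:R.

Definition copy_params (K : fieldType) (G : tn_graph) (k : nat)
    (M : pred (ent_edge G)) : params K G k.+1 k.+1 :=
  [ffun z : param_index G k.+1 k.+1 => copy_tensor K M (tagged z)].

(** The only index assignment with a nonzero contribution is the one read off
    from the sources of the edges, and the targets accept it exactly when the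
    two ends of each edge of [M] carry equal physical indices. *)
Lemma psi_copy_params (K : fieldType) (G : tn_graph) (k : nat)
    (M : pred (ent_edge G)) (x : {ffun vertex G -> 'I_k.+1}) :
  psi (copy_params K k M) x = [forall e in M, x (src e) == x (tgt e)]%:R.
Proof.
pose read (h : ent_edge G -> vertex G) : {ffun ent_edge G -> 'I_k.+1} :=
  [ffun e => if M e then x (h e) else ord0].
transitivity (\sum_c ((c == read (@tgt G)) && (c == read (@src G)))%:R : K).
  rewrite ffunE; apply: eq_bigr => c _.
  transitivity (\prod_(v : vertex G)
      ([forall (e | tgt e == v), c e == if M e then x v else ord0] &&
       [forall (e | src e == v), c e == if M e then x v else ord0])%:R : K).
    apply: eq_bigr => v _; rewrite /local_tensor ffunE /=.
    congr ((_ && _)%:R); apply/forallP/forall_inP => [h e ev|h e].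
    - by have := h (exist _ e ev); rewrite ffunE.
    - by rewrite ffunE; apply: h; apply: valP e.
    - by have := h (exist _ e ev); rewrite ffunE.
    - by rewrite ffunE; apply: h; apply: valP e.
  have [/andP[/eqP ct /eqP cs]|/nandP neq] := boolP (_ && _).
    apply: big1 => v _.
    suff -> : [forall (e | tgt e == v), c e == if M e then x v else ord0] &&
              [forall (e | src e == v), c e == if M e then x v else ord0] by [].
    apply/andP; split; apply/forall_inP => e /eqP <-.
      by rewrite ct ffunE.
    by rewrite cs ffunE.
  have ex_neq h : c != read h ->
      exists e, c e != if M e then x (h e) else ord0.
    move=> neq_h; apply/existsP; apply: contraNT neq_h => /existsPn eq_h.
    by apply/eqP/ffunP => e; rewrite ffunE; apply/eqP/negPn/eq_h.
  case: neq => /ex_neq[e neq_e].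
    rewrite (bigD1 (tgt e)) //=; case: forall_inP => [/(_ e (eqxx _))|_].
      by rewrite (negPf neq_e).
    by rewrite mul0r.
  rewrite (bigD1 (src e)) //= andbC; case: forall_inP => [/(_ e (eqxx _))|_].
    by rewrite (negPf neq_e).
  by rewrite mul0r.
rewrite (bigD1 (read (@src G))) //= eqxx andbT big1 => [|c /negPf ->].
  rewrite addr0; congr (_ %:R); congr nat_of_bool.
  apply/eqP/forall_inP => [/ffunP eq_read e Me|eq_x].
    by have := eq_read e; rewrite !ffunE (Me : M e) => ->.
  by apply/ffunP => e; rewrite !ffunE; case: ifP => // Me; apply/eqP/eq_x.
by rewrite andbF.
Qed.

Definition upper_down (N : nat) : pred (ent_edge (torus_grid2 N)) :=
  fun e => e.2 && ~~ e.1.2.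

Lemma flat_copy_params (K : fieldType) (N k : nat) :
  flat (psi (copy_params K k (@upper_down N))) = 1%:M.
Proof.
apply/matrixP => i j; rewrite !mxE -(inj_eq enum_val_inj).
apply: (etrans (psi_copy_params _ _ _)); congr (_ %:R); congr nat_of_bool.
apply/forall_inP/eqP => [eq_x|-> [[q [|]] [|]] //= _].
  apply/ffunP => q.
  by have /eqP := eq_x ((q, false), true) isT; rewrite !ffunE.
by rewrite !ffunE.
Qed.

Theorem theorem1p10 (R : realType) (N : nat) (hN : (2 <= N)%N) (hev : ~~ odd N) :
  @generic_in_TNS (complex R) (torus_grid2 N) 2 2
    (fun t => (2 ^ N <= border_rank t)%N).
Proof.
exists [set T : params (complex R) (torus_grid2 N) 2 2 |
          \det (flat (psi T)) != 0]%classic; split.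
- apply: zariski_open_neq0; apply: polynomial_det => i j.
  have [p pE] := @polynomial_psi (complex R) (torus_grid2 N) 2 2
                   (join_halves (enum_val i) (enum_val j)).
  by exists p => T; rewrite pE mxE.
- exists (copy_params _ 1 (@upper_down N)).
  by rewrite /= flat_copy_params det1 oner_neq0.
- move=> T /(border_rank_ge (Ordinal (ltnW hN))).
  by rewrite card_ord.
Qed.
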